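(* Let $(T,d)$ be a metric space satisfying condition (T1) below. Then the following conditions (T2a)–(T2j) are all equivalent: (T2a) For any $x,y\in T$ and any $z\in(x,y)$, the points $x$ and $y$ lie in different connected components of $T\setminus\{z\}$. (T2b) For any $x,y,z\in T$, $[y,z]\subseteq[x,y]\cup[x,z]$. (T2c) For any $x,y,z\in T$, $[x,y]\cap[x,z]\cap[y,z]\neq\emptyset$. (T2d) For any $x,y,z\in T$, $\gamma(x,y,z)\in[y,z]$. (T2e) For any injective continuous map $\psi:[0,1]\to T$, $d(\psi(0),\psi(t))+d(\psi(t),\psi(1))=d(\psi(0),\psi(1))$ for all $t\in[0,1]$. (T2f) For any injective continuous map $\psi:[0,1]\to T$, $\psi([0,1])\subseteq[\psi(0),\psi(1)]$. (T2g) For any injective continuous map $\psi:[0,1]\to T$, $\psi([0,1])=[\psi(0),\psi(1)]$. (T2h) For any injective continuous map $\psi:[0,1]\to T$, with $x=\psi(0)$, $y=\psi(1)$, one has $\psi=\varphi_{x,y}\circ h$ for some strictly increasing homeomorphism $h:[0,1]\to[0,d(x,y)]$. (T2i) For any injective continuous map $\psi:[0,1]\to T$, $\psi([0,1])\supseteq[\psi(0),\psi(1)]$. (T2j) For any continuous map $\psi:[0,1]\to T$, $\psi([0,1])\supseteq[\psi(0),\psi(1)]$.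
   Context: Condition (T1) on a metric space $(T,d)$: for any $x,y\in T$ there exists a unique isometric embedding $\varphi_{x,y}:[0,d(x,y)]\to T$ with $\varphi_{x,y}(0)=x$ and $\varphi_{x,y}(d(x,y))=y$. Under (T1), $[x,y]$ denotes the image $\varphi_{x,y}([0,d(x,y)])$, and $(x,y):=[x,y]\setminus\{x,y\}$. For $x,y,z\in T$ define $\delta(x,y,z):=\max\{t\in[0,\min(d(x,y),d(x,z))]:\varphi_{x,y}(t)=\varphi_{x,z}(t)\}$ (the maximum exists by continuity) and $\gamma(x,y,z):=\varphi_{x,y}(\delta(x,y,z))=\varphi_{x,z}(\delta(x,y,z))$. *)

(* Defs.v *)
From HB Require Import structures.
From mathcomp Require Import all_boot all_order all_algebra.
From mathcomp Require Import all_classical all_reals all_analysis.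
Import Order.TTheory GRing.Theory Num.Theory.
Import numFieldNormedType.Exports.

Set Implicit Arguments.
Unset Strict Implicit.
Unset Printing Implicit Defensive.

Local Open Scope classical_set_scope.
Local Open Scope ring_scope.

(* A map defined on a real interval [a, b] is represented by a total function on
   R of which only the restriction to `[a, b] is used: continuity, injectivity,
   uniqueness and equality are all relative to `[a, b]. *)

Definition homeomorphism_on (U V : topologicalType) (A : set U) (B : set V)
    (h : U -> V) : Prop :=
  [/\ set_bij A B h, {within A, continuous h} &
      exists2 g : V -> U, {in A, cancel h g} & {within B, continuous g}].

Section GeodesicSpace.
Context {R : realType} {T : metricType R}.
Implicit Types (x y z : T) (f psi : R -> T).

Definition isometric_on (A : set R) f : Prop :=
  {in A &, forall s t, mdist (f s) (f t) = `|s - t|}.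

Definition is_geodesic x y f : Prop :=
  [/\ isometric_on `[0, mdist x y] f, f 0 = x & f (mdist x y) = y].

(* When no geodesic from x to y exists, phi x y is the junk value cst x. *)
Definition phi x y : R -> T := xget (cst x) (is_geodesic x y).

Definition segment x y : set T := phi x y @` `[0, mdist x y].

Definition open_segment x y : set T := segment x y `\` [set x; y].

Definition agree_set x y z : set R :=
  [set t | t \in `[0, Num.min (mdist x y) (mdist x z)] /\
           phi x y t = phi x z t].

(* The greatest element of agree_set x y z; see deltaP. *)
Definition delta x y z : R :=
  xget 0 (agree_set x y z `&` ubound (agree_set x y z)).

Definition gamma x y z : T := phi x y (delta x y z).

Definition injective_path psi : Prop :=
  {within `[0, 1], continuous psi} /\ set_inj `[0, 1] psi.

End GeodesicSpace.

Section Conditions.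
Context {R : realType} (T : metricType R).

Definition T1 : Prop := forall x y : T,
  exists2 f : R -> T, is_geodesic x y f &
    forall g, is_geodesic x y g -> {in `[0, mdist x y], g =1 f}.

Definition T2a : Prop := forall x y z : T, open_segment x y z ->
  connected_component (~` [set z]) x <> connected_component (~` [set z]) y.

Definition T2b : Prop := forall x y z : T,
  segment y z `<=` segment x y `|` segment x z.

Definition T2c : Prop := forall x y z : T,
  segment x y `&` segment x z `&` segment y z !=set0.

Definition T2d : Prop := forall x y z : T, segment y z (gamma x y z).

Definition T2e : Prop := forall psi : R -> T, injective_path psi ->
  {in `[0, 1], forall t,
    mdist (psi 0) (psi t) + mdist (psi t) (psi 1) = mdist (psi 0) (psi 1)}.

Definition T2f : Prop := forall psi : R -> T, injective_path psi ->
  psi @` `[0, 1] `<=` segment (psi 0) (psi 1).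

Definition T2g : Prop := forall psi : R -> T, injective_path psi ->
  psi @` `[0, 1] = segment (psi 0) (psi 1).

Definition T2h : Prop := forall psi : R -> T, injective_path psi ->
  exists h : R -> R,
    [/\ homeomorphism_on (`[0, 1] : set R)
          (`[0, mdist (psi 0) (psi 1)] : set R) h,
        {in `[0, 1] &, {homo h : s t / s < t}} &
        {in `[0, 1], psi =1 phi (psi 0) (psi 1) \o h}].

Definition T2i : Prop := forall psi : R -> T, injective_path psi ->
  segment (psi 0) (psi 1) `<=` psi @` `[0, 1].

Definition T2j : Prop := forall psi : R -> T,
  {within `[0, 1], continuous psi} ->
  segment (psi 0) (psi 1) `<=` psi @` `[0, 1].

End Conditions.

Section WellDefined.
Context {R : realType} {T : metricType R}.
Context (hT1 : T1 T).
Implicit Types x y z : T.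

Lemma phiP x y : is_geodesic x y (phi x y).
Proof. by have [f Hf _] := hT1 x y; exact: (xgetI (cst x) Hf). Qed.

Lemma phi_unique x y f :
  is_geodesic x y f -> {in `[0, mdist x y], f =1 phi x y}.
Proof.
move=> Hf t Ht; have [g _ Hg] := hT1 x y.
by rewrite (Hg _ Hf) // (Hg _ (phiP x y)).
Qed.

Lemma deltaP x y z :
  agree_set x y z (delta x y z) /\ ubound (agree_set x y z) (delta x y z).
Proof.
set A := agree_set x y z.
have A0 : A 0.
  split; last by case: (phiP x y) => _ -> _; case: (phiP x z) => _ -> _.
  by rewrite in_itv /= lexx le_min !mdist_ge0.
have subA : forall t, A t ->
    [/\ 0 <= t, t <= mdist x y & t <= mdist x z].
  by move=> t []; rewrite in_itv /= le_min => /and3P[].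
have supA : has_sup A.
  by split; [exists 0 | exists (mdist x y) => t /subA[]].
have s0 : 0 <= sup A by exact: (ub_le_sup (proj2 supA)).
have sy : sup A <= mdist x y.
  by apply: ge_sup; [exists 0 | move=> t /subA[]].
have sz : sup A <= mdist x z.
  by apply: ge_sup; [exists 0 | move=> t /subA[]].
suff AsA : (A `&` ubound A) (sup A) by exact: (xgetI 0 AsA).
split; last exact: sup_upper_bound.
split; first by rewrite in_itv /= s0 le_min sy sz.
apply: mdist_positivity; apply/eqP; rewrite eq_le mdist_ge0 andbT.
apply/ler_addgt0Pl => e e0; rewrite addr0.
have e20 : 0 < e / 2 by rewrite divr_gt0.
have [t At lt_t] := sup_adherent e20 supA.
have [t0 ty tz] := subA _ At.
have ts : t <= sup A by exact: (ub_le_sup (proj2 supA)).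
have [Iy _ _] := phiP x y; have [Iz _ _] := phiP x z.
apply: le_trans (metric_triangle _ (phi x y t) _) _.
rewrite [X in _ + mdist X _](proj2 At).
rewrite Iy ?inE /= ?in_itv /= ?s0 ?sy ?t0 ?ty //.
rewrite Iz ?inE /= ?in_itv /= ?s0 ?sz ?t0 ?tz //.
rewrite (distrC t) ger0_norm ?subr_ge0 //.
by rewrite [leRHS]splitr lerD // lerBlDl -lerBlDr ltW.
Qed.

Lemma gammaE x y z : gamma x y z = phi x z (delta x y z).
Proof. by have [[_]] := deltaP x y z. Qed.

End WellDefined.

(* Main.v *)
Require Import Defs.
From mathcomp Require Import all_boot all_order all_algebra.
From mathcomp Require Import all_classical all_reals all_analysis.
From mathcomp Require Import lra.
Import Order.TTheory GRing.Theory Num.Theory.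
Import numFieldNormedType.Exports.

Set Implicit Arguments.
Unset Strict Implicit.
Unset Printing Implicit Defensive.

Local Open Scope classical_set_scope.
Local Open Scope ring_scope.

(** Concatenating geodesics shows that, by uniqueness, [segment x y] is the set of
    points [z] with [d x z + d z y = d x y]; (T2b), (T2c), (T2d) are then metric
    computations on triangles.  For the topological conditions: under (T2b),
    whether [z] lies on [segment x p] is locally constant in [p] off [z], which
    gives (T2a); a connected image joining [x] to [y] must then meet every point
    of [segment x y], which gives (T2j) and (T2i); and (T2i) applied to the arc
    made of the two branches of a tripod returns (T2b).  Finally (T2c) and (T2j)
    force an injective path to stay in the segment of its end points, and the
    distance to the origin reparametrizes it as in (T2h). *)

(** * Short paths and their concatenation *)

Section Metric.
Context {R : realType} {T : metricType R}.
Implicit Types (x y z p : T) (f g psi : R -> T).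

Lemma mdist_continuous p : continuous (mdist p : T -> R).
Proof.
move=> q; apply/cvgrPdist_lt => e e0.
near=> r.
have qr : mdist q r < e.
  by near: r; apply: (@metricType_numDomainType.cvgr_dist_lt _ _ _ (nbhs q) _ id).
have := metric_triangle p q r; have := metric_triangle p r q.
rewrite (metric_sym r q) ltr_norml => *; apply/andP; split; lra.
Unshelve. all: by end_near. Qed.

Lemma lipschitz_within_continuous (k a b : R) f :
  (forall s t, a <= s -> s <= t -> t <= b -> mdist (f s) (f t) <= k * (t - s)) ->
  {within `[a, b], continuous f}.
Proof.
move=> lipf; apply/subspace_continuousP => s /=; rewrite in_itv /= => /andP[as_ sb].
apply/metricType_numDomainType.cvgrPdist_lt => e e0.
pose d := e / (`|k| + 1).
have k0 : 0 < `|k| + 1 by rewrite ltr_wpDl.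
have d0 : 0 < d by rewrite divr_gt0.
rewrite near_withinE; near=> t; rewrite /= in_itv /= => /andP[at_ tb].
have std : `|s - t| < d.
  by near: t; apply: (@cvgr_dist_lt _ _ _ (nbhs s) _ id).
have lip : mdist (f s) (f t) <= `|k| * `|s - t|.
  have [st|/ltW ts] := leP s t.
    apply: le_trans (lipf _ _ as_ st tb) _.
    rewrite distrC (ger0_norm (x := t - s)) ?subr_ge0 //.
    by rewrite ler_wpM2r ?subr_ge0 // ler_norm.
  rewrite metric_sym (ger0_norm (x := s - t)) ?subr_ge0 //.
  apply: le_trans (lipf _ _ at_ ts sb) _.
  by rewrite ler_wpM2r ?subr_ge0 // ler_norm.
apply: le_lt_trans lip _; rewrite -(divfK (lt0r_neq0 k0) e) -/d mulrC.
apply: le_lt_trans (_ : `|s - t| * (`|k| + 1) < _).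
  by rewrite ler_wpM2l // lerDl.
by rewrite ltr_pM2r.
Unshelve. all: by end_near. Qed.

(** Being 1-Lipschitz, unlike being isometric, survives concatenation; [short_geodesic] then
    recovers the isometry from the end points. *)
Definition short_on (D : R) f :=
  forall s t, 0 <= s -> s <= t -> t <= D -> mdist (f s) (f t) <= t - s.

Definition concat (a : R) f g : R -> T :=
  fun t => if t <= a then f t else g (t - a).

Lemma short_concat (a b : R) f g : f a = g 0 ->
  short_on a f -> short_on b g -> short_on (a + b) (concat a f g).
Proof.
move=> fg sf sg s t s0 st tab; rewrite /concat.
have [sa|sa] := leP s a; have [ta|ta] := leP t a.
- exact: sf.
- have := metric_triangle (f s) (f a) (g (t - a)); rewrite {2}fg.
  have := sf s a; have := sg 0 (t - a); lra.
- lra.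
- have := sg (s - a) (t - a); lra.
Qed.

(** The upper bounds on the legs from [x] to [f s], from [f s] to [f t] and from [f t] to [y] add up
    to [mdist x y], so the triangle inequality forces equality in each. *)
Lemma short_geodesic x y f :
  short_on (mdist x y) f -> f 0 = x -> f (mdist x y) = y -> is_geodesic x y f.
Proof.
move=> sf f0 fD; split => //.
have main s t : 0 <= s -> s <= t -> t <= mdist x y -> mdist (f s) (f t) = t - s.
  move=> s0 st tD; apply/eqP; rewrite eq_le sf //=.
  have := metric_triangle x (f s) y; have := metric_triangle (f s) (f t) y.
  have := sf 0 s; have := sf t (mdist x y); rewrite f0 fD; lra.
move=> s t; rewrite !inE /= !in_itv /= => /andP[s0 sD] /andP[t0 tD].
have [st|/ltW ts] := leP s t; first by rewrite main // distrC ger0_norm // subr_ge0.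
by rewrite metric_sym main // ger0_norm // subr_ge0.
Qed.

End Metric.

Lemma within_continuous_comp_fun (U V W : topologicalType) (A : set U)
    (B : set V) (k : U -> V) (f : V -> W) :
  continuous k -> set_fun A B k -> {within B, continuous f} ->
  {within A, continuous (f \o k)}.
Proof.
move=> ck kAB /subspace_continuousP cf; apply/subspace_continuousP => u Au.
apply: cvg_comp (cf _ (kAB _ Au)) => P; rewrite /within /= => BP.
have := ck u _ BP; rewrite !nbhs_simpl /=.
by apply: (@filterS _ (nbhs u)) => v /= + Av; apply; exact: kAB.
Qed.


(** * Geodesics and segments under (T1) *)

Section UniquelyGeodesic.
Context {R : realType} {T : metricType R}.
Context (hT1 : T1 T).
Implicit Types (x y z p w : T) (psi : R -> T).

Lemma phi0 x y : phi x y 0 = x.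
Proof. by have [] := phiP hT1 x y. Qed.

Lemma phi_mdist x y : phi x y (mdist x y) = y.
Proof. by have [] := phiP hT1 x y. Qed.

Lemma mdist_phi x y s t : 0 <= s -> s <= t -> t <= mdist x y ->
  mdist (phi x y s) (phi x y t) = t - s.
Proof.
move=> s0 st tD; have [iso _ _] := phiP hT1 x y.
rewrite iso ?inE /= ?in_itv /= ?s0 ?(le_trans s0 st) ?(le_trans st tD) //.
by rewrite distrC ger0_norm ?subr_ge0.
Qed.

Lemma mdist_phil x y t : 0 <= t -> t <= mdist x y -> mdist x (phi x y t) = t.
Proof. by move=> t0 tD; rewrite -{1}(phi0 x y) mdist_phi // subr0. Qed.

Lemma mdist_phir x y t : 0 <= t -> t <= mdist x y ->
  mdist (phi x y t) y = mdist x y - t.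
Proof. by move=> t0 tD; rewrite -{2}(phi_mdist x y) mdist_phi. Qed.

Lemma short_phi x y : short_on (mdist x y) (phi x y).
Proof. by move=> s t s0 st tD; rewrite mdist_phi. Qed.

(** For the converse, the geodesics from [x] to [z] and from [z] to [y] concatenate to a short path
    of length [mdist x y], hence to a geodesic; uniqueness identifies it with [phi x y], which thus
    passes through [z]. *)
Lemma segmentP x y z :
  segment x y z <-> mdist x z + mdist z y = mdist x y.
Proof.
split=> [[t /=]|xzy].
  rewrite in_itv /= => /andP[t0 tD] <-.
  by rewrite mdist_phil // mdist_phir // subrKC.
have x0 := mdist_ge0 x z; have z0 := mdist_ge0 z y.
pose f := concat (mdist x z) (phi x z) (phi z y).
have fxz : f (mdist x z) = z by rewrite /f /concat lexx phi_mdist.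
have geo : is_geodesic x y f.
  apply: short_geodesic.
  - rewrite -xzy; apply: short_concat; [|exact: short_phi..].
    by rewrite phi_mdist phi0.
  - by rewrite /f /concat x0 phi0.
  (* If [z = y], the end time still falls in the first branch of [concat]. *)
  - rewrite /f /concat -xzy; case: leP => [h|_]; last first.
      by rewrite addrAC subrr add0r phi_mdist.
    have zy : mdist z y = 0 by lra.
    by rewrite zy addr0 phi_mdist; exact: mdist_positivity.
exists (mdist x z); first by rewrite /= in_itv /= x0; lra.
by rewrite -(phi_unique hT1 geo) // in_itv /= x0; lra.
Qed.

Lemma phi_segment x y z : segment x y z -> phi x y (mdist x z) = z.
Proof.
by move=> [t /=]; rewrite in_itv /= => /andP[t0 tD] <-; rewrite mdist_phil.
Qed.

Lemma segment_sym x y : segment x y `<=` segment y x.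
Proof.
move=> z /segmentP h; apply/segmentP.
by rewrite (metric_sym y z) (metric_sym z x) (metric_sym y x) addrC.
Qed.

Lemma segment_subl x y z : segment x y z -> segment x z `<=` segment x y.
Proof.
move=> /segmentP xzy p /segmentP xpz; apply/segmentP.
have := metric_triangle p z y; have := metric_triangle x p y; lra.
Qed.

Lemma segment_right x y : segment x y y.
Proof. by apply/segmentP; rewrite mdistxx addr0. Qed.

Lemma segmentxx x z : segment x x z -> z = x.
Proof.
move=> /segmentP; rewrite mdistxx => xzx; apply/esym/mdist_positivity.
by have := mdist_ge0 x z; have := mdist_ge0 z x; lra.
Qed.

(** * Triangles: (T2b), (T2c) and (T2d) *)

(* The witness sits at the Gromov product of [x] and [z] based at [y], where
   the defects of betweenness on the two sides coincide. *)
Lemma T2b_T2c : T2b T -> T2c T.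
Proof.
move=> hb x y z; pose t := (mdist x y + mdist y z - mdist x z) / 2.
have xyz := metric_triangle x y z; have yxz := metric_triangle y x z.
have xzy := metric_triangle x z y.
move: yxz xzy; rewrite (metric_sym y x) (metric_sym z y) => yxz xzy.
have t0 : 0 <= t by rewrite /t; lra.
have tD : t <= mdist y z by rewrite /t; lra.
set w := phi y z t.
have yw : mdist y w = t by rewrite mdist_phil.
have wz : mdist w z = mdist y z - t by rewrite mdist_phir.
have yzw : segment y z w by apply/segmentP; lra.
have eqv : segment x y w <-> segment x z w.
  by split=> /segmentP h; apply/segmentP; move: h;
    rewrite (metric_sym w y) yw wz /t; lra.
by exists w; have [/[dup] /eqv|/[dup] /eqv] := hb x y z w yzw.
Qed.

Lemma delta_bounds x y z : [/\ 0 <= delta x y z, delta x y z <= mdist x y &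
  delta x y z <= mdist x z].
Proof.
have [[+ _] _] := deltaP hT1 x y z.
by rewrite in_itv /= le_min => /and3P[].
Qed.

(** Both geodesics reach [w] at time [mdist x w], which is therefore a time of agreement. *)
Lemma segment_le_delta x y z w : segment x y w -> segment x z w ->
  mdist x w <= delta x y z.
Proof.
move=> yw zw; have [_] := deltaP hT1 x y z; apply; split.
  move: yw zw => /segmentP yw /segmentP zw.
  rewrite in_itv /= mdist_ge0 le_min /=.
  by rewrite -yw -zw !lerDl !mdist_ge0.
by rewrite !phi_segment.
Qed.

Lemma gamma_segmentl x y z : segment x y (gamma x y z).
Proof.
have [d0 dy _] := delta_bounds x y z.
by exists (delta x y z) => //=; rewrite in_itv /= d0.
Qed.

Lemma gamma_segmentr x y z : segment x z (gamma x y z).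
Proof.
have [d0 _ dz] := delta_bounds x y z.
by exists (delta x y z); rewrite ?(gammaE hT1) //= in_itv /= d0.
Qed.

(** With [g] the branch point and [w] a common point of the three sides, the path from [y] to [z]
    through [g] has length [mdist x y + mdist x z - 2 * delta x y z]. As [mdist x w <= delta x y z],
    this is at most the length through [w], which is [mdist y z]. *)
Lemma T2c_T2d : T2c T -> T2d T.
Proof.
move=> hc x y z; have [w [[xyw xzw] yzw]] := hc x y z.
have le_d := segment_le_delta xyw xzw.
have [d0 dy dz] := delta_bounds x y z.
have xg : mdist x (gamma x y z) = delta x y z by rewrite mdist_phil.
move: xyw xzw yzw => /segmentP xyw /segmentP xzw /segmentP yzw.
have /segmentP xyg := gamma_segmentl x y z.
have /segmentP xzg := gamma_segmentr x y z.
apply/segmentP.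
have := metric_triangle y (gamma x y z) z.
move: xyw yzw xyg; rewrite (metric_sym w y) (metric_sym (gamma x y z) y) => *.
lra.
Qed.

Lemma segment_split y z g p : segment y z g -> segment y z p ->
  segment y g p \/ segment g z p.
Proof.
move=> [t /=]; rewrite in_itv /= => /andP[t0 tD] <-.
move=> [s /=]; rewrite in_itv /= => /andP[s0 sD] <-.
have [st|/ltW ts] := leP s t; [left|right]; apply/segmentP.
  by rewrite !mdist_phil // mdist_phi // subrKC.
by rewrite !mdist_phir // mdist_phi //; lra.
Qed.

(** The branch point cuts the side from [y] to [z] into two pieces, each contained in one of the
    other sides. *)
Lemma T2d_T2b : T2d T -> T2b T.
Proof.
move=> hd x y z p yzp.
have [ygp|gzp] := segment_split (hd x y z) yzp; [left|right]; apply: segment_sym.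
  exact: segment_subl (segment_sym (gamma_segmentl x y z)) _ ygp.
exact: segment_subl (segment_sym (gamma_segmentr x y z)) _ (segment_sym gzp).
Qed.

(** * Connectedness and arcs: (T2a), (T2j) and (T2i) *)

(* Membership of [z] in [segment x p] is locally constant in [p] away from [z],
   so it separates [x] from [y] in the complement of [z]. *)
Lemma T2b_T2a : T2b T -> T2a T.
Proof.
move=> hb x y z [xyz nz] eqc.
have zx : x <> z by move=> e; apply: nz; left.
have zy : y <> z by move=> e; apply: nz; right.
(* By (T2b), [z] lies on the side from [p] to [x] or on the one from [p] to [q]; the latter is too
   short to reach [z]. *)
have key p q : mdist p q < mdist p z -> segment x q z -> segment x p z.
  move=> pq xqz; have [/segment_sym//|/segmentP pzq] := hb p x q z xqz.
  by have := mdist_ge0 z q; lra.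
pose C := [set p : T | p <> z /\ ~ segment x p z].
pose D := [set p : T | p <> z /\ segment x p z].
have oC : open C.
  rewrite openE => p [pz nxpz]; apply/nbhs_ballP; exists (mdist p z) => /=.
    by rewrite mdist_gt0; apply/eqP.
  move=> q; rewrite ballEmdist /= => pq; split=> [qz|/(key p q pq)//].
  by move: pq; rewrite qz ltxx.
have oD : open D.
  (* Here [key] is used with [p] and [q] exchanged, which requires [mdist q p < mdist q z]; half the
     radius ensures it. *)
  rewrite openE => p [pz xpz]; apply/nbhs_ballP; exists (mdist p z / 2) => /=.
    by rewrite divr_gt0 // mdist_gt0; apply/eqP.
  move=> q; rewrite ballEmdist /= => pq; have := metric_triangle p q z => pqz.
  have := mdist_ge0 p q => pq0; split=> [qz|].
    by move: pq pq0; rewrite qz; lra.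
  by apply: (key q p) xpz; rewrite metric_sym; lra.
pose A := connected_component (~` [set z]) x.
(* [C] contains [x] and is clopen relative to the component [A], hence exhausts it. *)
have AE : A `&` C = A.
  apply: (@component_connected _ (~` [set z]) x).
  - exists x; split; first exact: connected_component_refl.
    by split=> // /segmentxx e; apply: zx.
  - by exists C.
  - exists (~` D); first exact: open_closedC.
    apply/seteqP; split=> p [Ap]; first by move=> [pz nxpz]; split=> // -[].
    move=> nDp; have pz := connected_component_sub Ap.
    by split=> //; split=> // xpz; apply: nDp.
have : A y by rewrite /A eqc; exact: connected_component_refl.
by rewrite -AE => -[_ []].
Qed.

Lemma T2a_T2j : T2a T -> T2j T.
Proof.
move=> ha psi cpsi z xyz; apply: contrapT => nz.
have img t : 0 <= t <= 1 -> (psi @` `[0, 1]) (psi t) by move=> t01; exists t.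
have im0 : (psi @` `[0, 1]) (psi 0) by apply: img; rewrite lexx ler01.
have im1 : (psi @` `[0, 1]) (psi 1) by apply: img; rewrite lexx ler01.
apply: (ha (psi 0) (psi 1) z).
  by split=> // -[] /= e; apply: nz; rewrite e.
apply: same_connected_component.
apply: (@connected_component_max _ _ (psi @` `[0, 1])) => //.
  by move=> p imp /= pz; apply: nz; rewrite -pz.
apply: connected_continuous_connected => //.
exact: segment_connected.
Qed.

Lemma T2j_T2i : T2j T -> T2i T.
Proof. by move=> hj psi [/hj]. Qed.

(* Beyond the branch point [gamma x y z] the segments to [y] and [z] are
   disjoint, so that their union is an arc from [y] to [z]. *)
Lemma T2i_T2b : T2i T -> T2b T.
Proof.
move=> hi x y z.
have [d0 dy dz] := delta_bounds x y z; have [[_ dE] dub] := deltaP hT1 x y z.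
set d := delta x y z in d0 dy dz dE dub.
pose a := mdist x y - d; pose b := mdist x z - d.
have a0 : 0 <= a by rewrite subr_ge0.
have b0 : 0 <= b by rewrite subr_ge0.
(* If both branches are trivial then [y = z]; otherwise [a + b > 0] permits rescaling to the unit
   interval. *)
have [ab0|ab0] := leP (a + b) 0.
  have yz : y = z.
    rewrite -(phi_mdist x y) -(phi_mdist x z).
    have -> : mdist x y = d by move: ab0 a0 b0; rewrite /a /b; lra.
    by have -> : mdist x z = d by move: ab0 a0 b0; rewrite /a /b; lra.
  by rewrite -yz => p /segmentxx ->; left; exact: segment_right.
(* [f] runs from [y] back to the branch point, and [g] from there to [z]. *)
pose f u := phi x y (mdist x y - u); pose g u := phi x z (d + u).
have sf : short_on a f.
  by move=> s t s0 st ta; rewrite /f metric_sym mdist_phi //; move: ta; rewrite /a; lra.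
have sg : short_on b g.
  by move=> s t s0 st tb; rewrite /g mdist_phi //; move: tb; rewrite /b; lra.
have fg : f a = g 0 by rewrite /f /g /a addr0 subKr.
pose psi t := concat a f g (t * (a + b)).
have cpsi : {within `[0, 1], continuous psi}.
  apply: (@lipschitz_within_continuous _ _ (a + b)) => s t s0 st t1.
  rewrite mulrC mulrBl; apply: short_concat fg sf sg _ _ _ _ _; rewrite ?mulr_ge0 //.
  - exact: ltW.
  - by rewrite ler_pM2r.
  - by rewrite -[leRHS]mul1r ler_pM2r.
have psi0 : psi 0 = y by rewrite /psi /concat mul0r a0 /f subr0 phi_mdist.
have psi1 : psi 1 = z.
  rewrite /psi /concat mul1r; case: leP => [h|_].
    have b00 : b = 0 by lra.
    by rewrite b00 addr0 fg -b00 /g /b subrKC phi_mdist.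
  by rewrite addrAC subrr add0r /g /b subrKC phi_mdist.
(* A common point would have the same distance to [x] on both branches, giving a time of agreement
   beyond the maximum [d]. *)
have disj u v : 0 <= u -> u <= a -> a < v -> v <= a + b -> f u <> g (v - a).
  move=> u0 ua av vb e.
  have Dy : mdist x (f u) = mdist x y - u.
    by rewrite mdist_phil //; move: ua; rewrite /a; lra.
  have Dz : mdist x (g (v - a)) = d + (v - a).
    by rewrite mdist_phil //; move: vb; rewrite /b; lra.
  have uv : mdist x y - u = d + (v - a) by rewrite -Dy e Dz.
  have : d + (v - a) <= d.
    apply: dub; split; last by rewrite -/(g _) -e /f uv.
    by rewrite in_itv /= le_min; apply/and3P; split; move: vb; rewrite /b; lra.
  lra.
have psi_inj : set_inj `[0, 1] psi.
  move=> s t; rewrite !inE /= !in_itv /= => /andP[s0 s1] /andP[t0 t1].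
  wlog st : s t s0 s1 t0 t1 / s <= t.
    by move=> h; have [st|/ltW ts] := leP s t; [exact: h|move/esym/h => ->].
  rewrite /psi /concat => e; apply: (mulIf (lt0r_neq0 ab0)).
  have stL : s * (a + b) <= t * (a + b) by rewrite ler_pM2r.
  have s0L : 0 <= s * (a + b) by rewrite mulr_ge0 // ltW.
  have t1L : t * (a + b) <= a + b by rewrite -[leRHS]mul1r ler_pM2r.
  move: (s * _) (t * _) e stL s0L t1L => u v + uv u0 vab.
  case: leP => ua; case: leP => va e.
  - have := mdistxx (f u); rewrite {2}e /f metric_sym mdist_phi; [lra|..];
      by move: va; rewrite /a; lra.
  - by case: (disj u v).
  - lra.
  - have := mdistxx (g (u - a)); rewrite {2}e /g mdist_phi; [lra|..];
      by move: vab; rewrite /b; lra.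
move=> p; rewrite -psi0 -psi1 => /(hi psi (conj cpsi psi_inj))[t /=].
rewrite in_itv /= psi0 psi1 => /andP[t0 t1] <-; rewrite /psi /concat.
have t0L : 0 <= t * (a + b) by rewrite mulr_ge0 // ltW.
have t1L : t * (a + b) <= a + b by rewrite -[leRHS]mul1r ler_pM2r.
move: (t * _) t0L t1L => u u0 uab.
case: leP => ua; [left; exists (mdist x y - u)|right; exists (d + (u - a))] => //=;
  rewrite in_itv /=; apply/andP; split; move: ua uab; rewrite /a /b; lra.
Qed.

(** * Injective paths and their reparametrization *)

Lemma T2eP : T2e T <-> T2f T.
Proof.
split=> h psi ipsi.
  by move=> _ [t t01 <-]; apply/segmentP; exact: h.
by move=> t t01; apply/segmentP; apply: (h psi ipsi); exists t.
Qed.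

(* The triple intersection point of [psi 0], [psi t], [psi 1] lies on both
   halves of the path, hence it is [psi t] by injectivity. *)
Lemma T2c_T2j_T2f : T2c T -> T2j T -> T2f T.
Proof.
move=> hc hj psi [cpsi ipsi] q [t /=]; rewrite in_itv /= => /andP[t0 t1] <-.
(* (T2j) is transferred to the subpath over [[u, v]] by an affine change of parameter. *)
have sub u v : 0 <= u -> u <= v -> v <= 1 ->
    segment (psi u) (psi v) `<=` psi @` `[u, v].
  move=> u0 uv v1 p.
  pose k s := u + s * (v - u).
  have kb s : 0 <= s -> s <= 1 -> u <= k s <= v.
    move=> s0 s1; have vu : 0 <= v - u by rewrite subr_ge0.
    by rewrite /k lerDl mulr_ge0 //= -lerBrDl ler_piMl.
  have ck : {within `[0, 1], continuous (psi \o k)}.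
    apply: within_continuous_comp_fun cpsi.
      move=> s; apply: cvgD; first exact: cvg_cst.
      by apply: cvgM; [exact: cvg_id|exact: cvg_cst].
    move=> s /=; rewrite !in_itv /= => /andP[s0 s1].
    by have /andP[us sv] := kb s s0 s1; rewrite (le_trans u0 us) (le_trans sv v1).
  have := hj _ ck p; rewrite /= /k mul0r addr0 mul1r subrKC => h /h[s /=].
  rewrite in_itv /= => /andP[s0 s1] <-; exists (k s) => //=.
  by rewrite in_itv /= kb.
have [w [[w01 w0t] w1t]] := hc (psi 0) (psi 1) (psi t).
have [u /=] := sub 0 t (lexx 0) t0 t1 w w0t.
rewrite in_itv /= => /andP[u0 ut] uw.
have [v /=] := sub t 1 t0 t1 (lexx 1) w (segment_sym w1t).
rewrite in_itv /= => /andP[tv v1] vw.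
have uv : u = v.
  by apply: ipsi; rewrite ?uw ?vw // inE /= in_itv /=; apply/andP; split; lra.
have -> : t = u by lra.
by rewrite uw.
Qed.

(** On a segment a point is determined by its distance to the origin, so [h] inherits injectivity
    from [psi]; being continuous with [h 0 <= h 1], it is then increasing. *)
Lemma T2f_T2h : T2f T -> T2h T.
Proof.
move=> hf psi ipath; have [cpsi ipsi] := ipath.
pose h t := mdist (psi 0) (psi t).
have hE t : t \in `[0, 1] -> phi (psi 0) (psi 1) (h t) = psi t.
  by move=> t01; apply: phi_segment; apply: hf => //; exists t.
have ch : {within `[0, 1], continuous h}.
  by apply: within_continuous_comp cpsi => p _; exact: mdist_continuous.
have h0 : h 0 = 0 by rewrite /h mdistxx.
have h1 : h 1 = mdist (psi 0) (psi 1) by [].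
have hinj : {in `[0, 1] &, injective h}.
  by move=> s t s01 t01 st; apply: ipsi; rewrite ?inE // -hE // st hE.
have h01 : h 0 <= h 1 by rewrite h0 mdist_ge0.
have hmono := segment_continuous_inj_le h01 ch hinj.
pose g v := xget 0 [set t | t \in `[0, 1] /\ h t = v].
have hK : {in `[0, 1], cancel h g}.
  move=> t t01; have ex : [set s | s \in `[0, 1] /\ h s = h t] t by [].
  by have [g01 /hinj] := xgetI 0 ex; apply.
exists h; split.
- split.
  + split.
    * move=> t /= t01; rewrite in_itv /= mdist_ge0 -h1 /= hmono ?bound_itvE ?ler01 //.
      by move: t01; rewrite in_itv => /andP[].
    * by move=> s t; rewrite !inE; exact: hinj.
    * by have := segment_continuous_le_surjective ler01 h01 ch; rewrite h0 h1.
  + exact: ch.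
  + exists g; first by move=> t; rewrite inE; exact: hK.
    by have := segment_can_le_continuous ler01 ch hK; rewrite h0 h1.
- by move=> s t s01 t01; rewrite (leW_mono_in hmono).
- by move=> t t01; rewrite /= hE.
Qed.

Lemma T2h_T2g : T2h T -> T2g T.
Proof.
move=> hh psi /hh[h [[[hfun _ hsurj] _ _] _ psiE]].
apply/seteqP; split=> p.
  by move=> [t t01 <-]; rewrite (psiE t) //; exists (h t) => //; exact: hfun.
by move=> [s /hsurj[t t01 <-] <-]; exists t => //; rewrite (psiE t).
Qed.

Lemma T2g_T2f : T2g T -> T2f T.
Proof. by move=> hg psi /hg ->. Qed.

Lemma T2g_T2i : T2g T -> T2i T.
Proof. by move=> hg psi /hg ->. Qed.

End UniquelyGeodesic.

Theorem theorem2p1 (R : realType) (T : metricType R) (hT1 : T1 T) :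
  [<-> T2a T; T2b T; T2c T; T2d T; T2e T; T2f T; T2g T; T2h T; T2i T; T2j T].
Proof.
(* The cycle below follows the order of the list, whereas (T2a), (T2i) and (T2j) are tied to the
   rest through (T2b). *)
have ab ha : T2b T := T2i_T2b hT1 (T2j_T2i (T2a_T2j ha)).
have ib hi : T2b T := T2i_T2b hT1 hi.
have bj hb : T2j T := T2a_T2j (T2b_T2a hT1 hb).
tfae.
- exact: ab.
- exact: T2b_T2c.
- exact: T2c_T2d.
- move=> /(T2d_T2b hT1) hb; apply/(T2eP hT1).
  exact: T2c_T2j_T2f (T2b_T2c hT1 hb) (bj hb).
- by move/(T2eP hT1).
- by move=> /(T2f_T2h hT1)/T2h_T2g.
- by move=> /T2g_T2f/(T2f_T2h hT1).
- by move=> /T2h_T2g/T2g_T2i.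
- by move=> /ib/bj.
- by move=> /T2j_T2i/ib/(T2b_T2a hT1).
Qed.
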